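(* For $r,s\in\mathbb N$ with $m=\max(r,s)\geq1$, let $1\leq\lambda_1<\cdots<\lambda_s\leq r$ if $r\geq s$, or $1\leq\sigma_1<\cdots<\sigma_r\leq s$ and $\sigma_{r+1}=s+1$ if $r\leq s$; let $\alpha=(\alpha_{k+m})_{k\in\mathbb N}$ be the sequence of rational expressions in $a_1,\dots,a_{r+1},b_1,\dots,b_s$ defined in the context, and suppose that $a_{r+1}=1$. Then, for each $k\in\mathbb N$, the generating function $\sum_{n=0}^{\infty}S^{(m;k)}_n(\alpha)\,t^n$ of the modified $m$-Stieltjes-Rogers polynomials of type $k$ is $$g_k(t)={}_{r+1}F_s\left(\left.\begin{matrix}a_1^{(k)},\dots,a_{r+1}^{(k)}\\ b_1^{(k)},\dots,b_s^{(k)}\end{matrix}\,\right|\,t\right),$$ and $$S^{(m;k)}_n(\alpha)=\binom{n+\left\lceil\frac{k-m}{m+1}\right\rceil}{n}\,\frac{\left(a_1^{(k)}\right)_n\cdots\left(a_r^{(k)}\right)_n}{\left(b_1^{(k)}\right)_n\cdots\left(b_s^{(k)}\right)_n}\qquad\text{for any }n,k\in\mathbb N.$$ In particular, $$S^{(m;k)}_n(\alpha)=\frac{\left(a_1^{(k)}\right)_n\cdots\left(a_r^{(k)}\right)_n}{\left(b_1^{(k)}\right)_n\cdots\left(b_s^{(k)}\right)_n}\qquad\text{for }n\in\mathbb N\text{ and }0\leq k\leq m.$$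
   Context: $\mathbb N=\{0,1,2,\dots\}$; $(z)_0=1$, $(z)_n=z(z+1)\cdots(z+n-1)$ for $n\ge1$; ${}_pF_q\left(\left.\begin{matrix}c_1,\dots,c_p\\ d_1,\dots,d_q\end{matrix}\,\right|\,t\right)=\sum_{n\ge0}\frac{(c_1)_n\cdots(c_p)_n}{(d_1)_n\cdots(d_q)_n}\frac{t^n}{n!}$ as a formal power series. The $a_i$ and $b_j$ (other than $a_{r+1}=1$) are indeterminates, and one works in $\mathbb Q(b_1,\dots,b_s)[a_1,\dots,a_r]$. For integers $k$ and $n\geq1$, $[k]_n$ is the unique element of $\{1,\dots,n\}$ congruent to $k$ modulo $n$. Parameters: if $r\geq s$, $a_i^{(k)}=a_i+\left\lceil\frac{k+1-i}{r+1}\right\rceil$ and $b_j^{(k)}=b_j+\left\lceil\frac{k+1-\lambda_j}{r}\right\rceil$; if $r\leq s$, $a_i^{(k)}=a_i+\left\lceil\frac{k+1-\sigma_i}{s+1}\right\rceil$ and $b_j^{(k)}=b_j+\left\lceil\frac{k+1-j}{s}\right\rceil$ (for $1\le i\le r+1$, $1\le j\le s$; the two agree when $r=s$, where $\lambda_j=j$, $\sigma_i=i$). Coefficients, for $k\in\mathbb N$. If $r\ge s$: $\alpha_{k+r}=\dfrac{\prod_{i=1,i\neq[k]_{r+1}}^{r+1}a_i^{(k)}}{\prod_{j=1}^{s}b_j^{(k)}}$ if $[k]_r\notin\{\lambda_1,\dots,\lambda_s\}$, and $\alpha_{k+r}=\dfrac{\left(b_\ell^{(k)}-a_{[k]_{r+1}}^{(k)}\right)\prod_{i=1,i\neq[k]_{r+1}}^{r+1}a_i^{(k)}}{\left(b_\ell^{(k)}-1\right)\prod_{j=1}^{s}b_j^{(k)}}$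 if $[k]_r=\lambda_\ell$. If $r\le s$: $\alpha_{k+s}=-\dfrac{\prod_{i=1}^{r+1}a_i^{(k)}}{\left(b_{[k]_s}^{(k)}-1\right)\prod_{j=1}^{s}b_j^{(k)}}$ if $[k]_{s+1}\notin\{\sigma_1,\dots,\sigma_{r+1}\}$, and $\alpha_{k+s}=\dfrac{\left(b_{[k]_s}^{(k)}-a_\ell^{(k)}\right)\prod_{i=1,i\neq\ell}^{r+1}a_i^{(k)}}{\left(b_{[k]_s}^{(k)}-1\right)\prod_{j=1}^{s}b_j^{(k)}}$ if $[k]_{s+1}=\sigma_\ell$. Modified $m$-Stieltjes-Rogers polynomials: a partial $m$-Dyck path is a finite path in $\mathbb N\times\mathbb N$ with steps $(1,1)$ (rises, weight $1$) and $(1,-m)$ ($m$-falls, weight $\alpha_i$ when starting from height $i$); $S^{(m;k)}_n(\alpha)$ is the sum of the weights (products of step weights) of the partial $m$-Dyck paths from $(0,0)$ to $((m+1)n+k,k)$. *)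

(* Defs.v *)
From mathcomp Require Import all_boot all_order all_algebra.
From mathcomp Require Import mpoly zify.

Set Implicit Arguments.
Unset Strict Implicit.
Unset Printing Implicit Defensive.

Import Order.TTheory GRing.Theory Num.Theory.

Local Open Scope ring_scope.

(* As in the source, the parameters [a_i], [b_j], [lambda_j], [sigma_i] are    *)
(* numbered from 1: such a family is a function on [nat] of which only the    *)
(* values at 1, 2, ... up to its length are used.                             *)

(** ** The coefficient ring Q(b_1, ..., b_s)[a_1, ..., a_r] *)

Definition ratfrac (s : nat) : fieldType := {fraction {mpoly rat[s]}}.

(* The units of this ring are exactly the nonzero elements of [ratfrac s], so *)
(* all the quotients below, whose denominators are free of the [a_i], are     *)
(* genuine ones.                                                              *)
Definition coefring (r s : nat) : comUnitRingType := {mpoly (ratfrac s)[r]}.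

(* The 0-based indeterminates: [var_a s i] is a_{i+1}, [var_b r j] is b_{j+1}. *)
Definition var_a (r s : nat) (i : 'I_r) : coefring r s := 'X_i.

Definition var_b (r s : nat) (j : 'I_s) : coefring r s :=
  (tofrac ('X_j : {mpoly rat[s]}) : ratfrac s)%:MP.

Lemma var_b_unit (r s : nat) (j : 'I_s) (z : int) :
  var_b r j + z%:~R \is a GRing.unit.
Proof.
have -> : var_b r j + z%:~R
    = (tofrac ('X_j + z%:~R : {mpoly rat[s]}) : ratfrac s)%:MP_[r].
  by rewrite /var_b rmorphD /= rmorph_int raddfD /= (rmorph_int (@mpolyC r _)).
rewrite unfold_in /= /mpoly_unit mcoeffC eqxx mulr1 unitfE tofrac_eq0.
apply/andP; split=> //; apply/eqP => /(congr1 (mcoeff U_(j))).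
rewrite mcoeff0 raddfD /= mcoeffX eqxx -(rmorph_int (@mpolyC s _)) /= mcoeffC.
by rewrite mnm1_eq0 mulr0 addr0 => /eqP; rewrite oner_eq0.
Qed.

(** ** Integer notions *)

Definition ceil_frac (x y : int) : int := Num.ceil (x%:Q / y%:Q).

(* For k, m in N, ceil((k - m) / (m + 1)) is a natural number.                *)
Lemma ceil_frac_ge0 (m k : nat) : 0 <= ceil_frac (k%:Z - m%:Z) m.+1.
Proof.
rewrite /ceil_frac ceil_ge0 ltr_pdivlMr ?ltr0z // mulN1r -mulrNz ltr_int; lia.
Qed.

(* [resid n k] is [k]_n, the element of {1, ..., n} congruent to k modulo n.  *)
Definition resid (n k : nat) : nat := if (n %| k)%N then n else (k %% n)%N.

Lemma resid_range (n k : nat) : (0 < n)%N -> (1 <= resid n k <= n)%N.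
Proof.
move=> n_gt0; rewrite /resid; case: ifP => [_|]; first by rewrite n_gt0 leqnn.
by rewrite /dvdn lt0n => ->; rewrite ltnW // ltn_mod.
Qed.

Lemma resid_mod (n k : nat) : (resid n k = k %[mod n])%N.
Proof.
by rewrite /resid; case: ifP => [/eqP->|_]; rewrite ?modnn ?modn_mod.
Qed.

(* [pos_in f n x] is the 1-based position of x among f 1, ..., f n, if any.   *)
Definition pos_in (f : nat -> nat) (n x : nat) : option nat :=
  omap (fun l : 'I_n => l.+1) [pick l : 'I_n | f l.+1 == x].

(* 1 <= f 1 < ... < f n <= N *)
Definition increasing_within (f : nat -> nat) (n N : nat) : Prop :=
  (forall j, (1 <= j <= n)%N -> (1 <= f j <= N)%N) /\
  (forall i j, (1 <= i)%N -> (i < j)%N -> (j <= n)%N -> (f i < f j)%N).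

(** ** Hypergeometric series *)

Definition poch (R : pzRingType) (z : R) (n : nat) : R :=
  \prod_(i < n) (z + i%:R).

(* A formal power series is given by its sequence of coefficients.            *)
Definition fps (R : Type) : Type := nat -> R.

Definition pFq (R : comUnitRingType) (cs ds : seq R) : fps R :=
  fun n => (\prod_(c <- cs) poch c n) / (\prod_(d <- ds) poch d n) / n`!%:R.

(** ** The shifted parameters and the coefficients alpha *)

Section Coefficients.

Variables (R : comUnitRingType) (r s : nat) (a b : nat -> R).

Section GE.

Variable lambda : nat -> nat.

Definition a_ge (k i : nat) : R :=
  a i + (ceil_frac (k%:Z + 1 - i%:Z) r.+1)%:~R.

Definition b_ge (k j : nat) : R :=
  b j + (ceil_frac (k%:Z + 1 - (lambda j)%:Z) r)%:~R.

Definition coef_ge (k : nat) : R :=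
  let p := resid r.+1 k in
  match pos_in lambda s (resid r k) with
  | None =>
      (\prod_(1 <= i < r.+2 | i != p) a_ge k i)
      / \prod_(1 <= j < s.+1) b_ge k j
  | Some l =>
      ((b_ge k l - a_ge k p) * \prod_(1 <= i < r.+2 | i != p) a_ge k i)
      / ((b_ge k l - 1) * \prod_(1 <= j < s.+1) b_ge k j)
  end.

(* alpha_h is only meaningful for h >= r, the index being h = k + r.          *)
Definition alpha_ge (h : nat) : R := coef_ge (h - r).

End GE.

Section LE.

Variable sigma : nat -> nat.

Definition a_le (k i : nat) : R :=
  a i + (ceil_frac (k%:Z + 1 - (sigma i)%:Z) s.+1)%:~R.

Definition b_le (k j : nat) : R :=
  b j + (ceil_frac (k%:Z + 1 - j%:Z) s)%:~R.

Definition coef_le (k : nat) : R :=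
  let q := resid s k in
  match pos_in sigma r.+1 (resid s.+1 k) with
  | None =>
      - ((\prod_(1 <= i < r.+2) a_le k i)
         / ((b_le k q - 1) * \prod_(1 <= j < s.+1) b_le k j))
  | Some l =>
      ((b_le k q - a_le k l) * \prod_(1 <= i < r.+2 | i != l) a_le k i)
      / ((b_le k q - 1) * \prod_(1 <= j < s.+1) b_le k j)
  end.

(* alpha_h is only meaningful for h >= s, the index being h = k + s.          *)
Definition alpha_le (h : nat) : R := coef_le (h - s).

End LE.

End Coefficients.

(** ** Partial m-Dyck paths and modified m-Stieltjes-Rogers polynomials *)

(* Every step increases the abscissa by 1, so a path from a given point is    *)
(* its sequence of steps ([true]: rise, [false]: m-fall) and the abscissa of  *)
(* its end is its length. [dyck_path m h k w]: starting from height h, the    *)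
(* steps w stay at heights >= 0 and end at height k.                          *)
Fixpoint dyck_path (m h k : nat) (w : seq bool) : bool :=
  match w with
  | [::] => h == k
  | true :: w' => dyck_path m h.+1 k w'
  | false :: w' => (m <= h)%N && dyck_path m (h - m) k w'
  end.

Fixpoint dyck_weight (R : pzRingType) (alpha : nat -> R) (m h : nat)
    (w : seq bool) : R :=
  match w with
  | [::] => 1
  | true :: w' => dyck_weight alpha m h.+1 w'
  | false :: w' => alpha h * dyck_weight alpha m (h - m) w'
  end.

Definition mSR (R : pzRingType) (m k n : nat) (alpha : nat -> R) : R :=
  \sum_(w : (m.+1 * n + k).-tuple bool | dyck_path m 0 k w)
    dyck_weight alpha m 0 w.

(* Main.v *)
(** Splitting a path at its last step gives
    S_{n+1}^{(k)} = S_{n+1}^{(k-1)} + alpha_{k+m} S_n^{(k+m)}, with the first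
    term absent for k = 0. This determines the numbers S_n^{(k)} from
    S_0^{(k)} = 1, so it suffices that the hypergeometric series satisfy
    g_k - g_{k-1} = alpha_{k+m} t g_{k+m} with g_{-1} = 1. The latter holds
    because a_{r+1} = 1 makes a_{r+1}^{(-1)} = 0. For the former, going from
    k - 1 to k raises by 1 at most one upper and at most one lower parameter,
    namely those whose index is congruent to k, whereas g_{k+m} has the upper
    parameters of g_{k-1} and the lower parameters of g_k, all increased by 1;
    this is a three-term contiguous relation. *)

Require Import Defs.
From mathcomp Require Import all_boot all_order all_algebra.
From mathcomp Require Import mpoly ring zify.

Set Implicit Arguments.
Unset Strict Implicit.
Unset Printing Implicit Defensive.

Import Order.TTheory GRing.Theory Num.Theory.

Local Open Scope ring_scope.

(** * Removing the last step of a path *)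

Lemma dyck_path_rcons_rise (m h k : nat) (w : seq bool) :
  dyck_path m h k (rcons w true) = (0 < k)%N && dyck_path m h k.-1 w.
Proof.
elim: w h => [|[] w IHw] h /=; last 1 first.
- by rewrite IHw andbCA.
- by case: k.
- exact: IHw.
Qed.

(** A last fall that ends at height k starts at height k + m, so its condition of starting at height
    at least m is automatic. *)
Lemma dyck_path_rcons_fall (m h k : nat) (w : seq bool) :
  dyck_path m h k (rcons w false) = dyck_path m h (k + m) w.
Proof.
by elim: w h => [|[] w IHw] h //=; rewrite ?IHw //; apply/idP/idP; lia.
Qed.

Lemma dyck_weight_rcons (R : pzRingType) (alpha : nat -> R) (m h k : nat)
    (w : seq bool) (c : bool) :
  dyck_path m h k w ->
  dyck_weight alpha m h (rcons w c)
  = dyck_weight alpha m h w * (if c then 1 else alpha k).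
Proof.
elim: w h => [|[] w IHw] h /=.
    by move=> /eqP->; case: c; rewrite ?mulr1 ?mul1r.
  exact: IHw.
by case/andP=> _ /IHw ->; rewrite mulrA.
Qed.

Lemma dyck_path_height (m h k : nat) (w : seq bool) :
  dyck_path m h k w -> (k <= h + size w)%N.
Proof.
elim: w h => [|[] w IHw] h /=; first by move=> /eqP->; lia.
  by move=> /IHw; lia.
by case/andP=> _ /IHw; lia.
Qed.

(** Appending a last entry is injective on pairs of a boolean and an L-tuple, and hence bijective,
    as the cardinalities agree. *)
Lemma big_tuple_rcons (R : nmodType) (L : nat) (P : pred (seq bool))
    (F : seq bool -> R) :
  \sum_(w : L.+1.-tuple bool | P w) F w
  = \sum_(w : L.-tuple bool | P (rcons w true)) F (rcons w true)
    + \sum_(w : L.-tuple bool | P (rcons w false)) F (rcons w false).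
Proof.
pose f (x : bool * L.-tuple bool) := [tuple of rcons x.2 x.1].
have f_bij : bijective f.
  apply: inj_card_bij => [[c w] [d v] /(congr1 val)/= /rcons_inj[/val_inj-> ->] //|].
  by rewrite card_prod !card_tuple card_bool expnS.
rewrite (reindex f) /=; last exact/onW_bij.
rewrite -(pair_big_dep xpredT (fun c w => P (rcons (tval w) c))
   (fun c w => F (rcons (tval w) c))) /=.
by rewrite big_bool.
Qed.

Section PathSums.

Variables (R : pzRingType) (alpha : nat -> R) (m : nat).

(** The length is left free, so that deleting a step stays within these sums; [mSR m k n alpha] is
    the case L = (m + 1) n + k. *)
Definition path_sum (L k : nat) : R :=
  \sum_(w : L.-tuple bool | dyck_path m 0 k w) dyck_weight alpha m 0 w.

Lemma path_sum_last (L k : nat) :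
  path_sum L.+1 k
  = (if k is k'.+1 then path_sum L k' else 0)
    + path_sum L (k + m) * alpha (k + m).
Proof.
rewrite /path_sum big_tuple_rcons; congr (_ + _).
  case: k => [|k]; first by apply: big1 => w; rewrite dyck_path_rcons_rise.
  apply: eq_big => w; rewrite dyck_path_rcons_rise //= => Pw.
  by rewrite (dyck_weight_rcons _ _ Pw) mulr1.
rewrite mulr_suml; apply: eq_big => w; rewrite dyck_path_rcons_fall //= => Pw.
by rewrite (dyck_weight_rcons _ _ Pw).
Qed.

Lemma path_sum_high (L k : nat) : (L < k)%N -> path_sum L k = 0.
Proof.
by move=> ltLk; apply: big1 => w /dyck_path_height; rewrite size_tuple; lia.
Qed.

Lemma mSR0 (k : nat) : mSR m k 0 alpha = 1.
Proof.
rewrite /mSR muln0; change (path_sum k k = 1).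
elim: k => [|k IHk]; last first.
  (* A path of length k cannot reach height k + 1 + m, so the term of a last fall vanishes. *)
  by rewrite path_sum_last IHk path_sum_high ?mul0r ?addr0 //; lia.
rewrite /path_sum (bigD1 [tuple]) //= big1 ?addr0 // => w.
by case/andP=> _ /eqP[]; rewrite (tuple0 w).
Qed.

Lemma mSRS (k n : nat) :
  mSR m k n.+1 alpha
  = (if k is k'.+1 then mSR m k' n.+1 alpha else 0)
    + mSR m (k + m) n alpha * alpha (k + m)%N.
Proof.
(* The shortened length is (m + 1) n + (k + m), which for k >= 1 is also (m + 1)(n + 1) + (k -
   1). *)
rewrite /mSR; have -> : (m.+1 * n.+1 + k = (m.+1 * n + (k + m)).+1)%N by lia.
rewrite -/(path_sum _ _) path_sum_last; congr (_ + _).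
case: k => // k; rewrite /path_sum.
by rewrite (_ : (m.+1 * n + (k.+1 + m) = m.+1 * n.+1 + k)%N) //; lia.
Qed.

(* [G K] is the series of type [K - 1], so that the recurrence also covers the
   first height, with [G 0 = 1]. *)
Lemma mSR_unique (G : nat -> nat -> R) :
  (forall K, G K 0 = 1) -> (forall n, G 0 n.+1 = 0) ->
  (forall k n, G k.+1 n.+1 = G k n.+1 + G (k + m).+1 n * alpha (k + m)%N) ->
  forall k n, mSR m k n alpha = G k.+1 n.
Proof.
move=> G0 G0S GS k n; elim: n k => [|n IHn] k; first by rewrite mSR0 G0.
elim: k => [|k IHk]; first by rewrite mSRS GS G0S IHn.
by rewrite mSRS GS IHk IHn.
Qed.

End PathSums.

(** * Ceilings of fractions *)

Lemma ceil_fracP (x c : int) (d : nat) : (0 < d)%N ->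
  (c - 1) * d%:Z < x <= c * d%:Z -> ceil_frac x d = c.
Proof.
move=> d_gt0 xc; apply/ceil_def; rewrite /ceil_frac.
rewrite ltr_pdivlMr ?ler_pdivrMr ?ltr0z -?intrM ?ltr_int ?ler_int //.
Qed.

Lemma ceil_frac_bounds (x : int) (d : nat) : (0 < d)%N ->
  (ceil_frac x d - 1) * d%:Z < x <= ceil_frac x d * d%:Z.
Proof.
move=> d_gt0; have := ceil_itv (x%:Q / d%:Z%:Q); rewrite -/(ceil_frac x d).
by rewrite ltr_pdivlMr ?ler_pdivrMr ?ltr0z -?intrM ?ltr_int ?ler_int.
Qed.

(** The ceiling of (k - i) / d goes up at the next k exactly when d divides k - i, which for i in 1,
    ..., d means i = [k]_d. *)
Lemma ceil_frac_next (d k i : nat) : (1 <= i <= d)%N ->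
  ceil_frac (k.+1%:Z - i%:Z) d
  = ceil_frac (k%:Z - i%:Z) d + (i == resid d k)%:Z.
Proof.
move=> i_range; have d_gt0 : (0 < d)%N by lia.
have := ceil_frac_bounds (k%:Z - i%:Z) d_gt0.
set c := ceil_frac _ d => c_bounds; apply: ceil_fracP => //.
have := resid_range k d_gt0; have := resid_mod d k; set p := resid d k.
move=> p_mod p_range.
have [q kE] : exists q : int, k%:Z = q * d%:Z + p%:Z.
  exists ((k %/ d)%:Z - (p %/ d)%:Z).
  have := divn_eq k d; have := divn_eq p d; lia.
(* Multiples of d that differ by less than d coincide; this identifies the quotient q with the
   ceiling c. *)
have small (t : int) : - d%:Z < t * d%:Z < d%:Z -> t = 0.
  case: (ltgtP t 0) => // t0; nia.
case: eqVneq => [ip|ip].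
  suff: q - c = 0 by move=> qc; move: kE; rewrite (_ : q = c); lia.
  apply: small; lia.
have : q * d%:Z + p%:Z - i%:Z <> c * d%:Z.
  move=> E; have qc : q - c = 0 by apply: small; lia.
  have qcE : q = c by lia.
  by move: E; rewrite qcE; lia.
lia.
Qed.

Lemma ceil_frac_period (d k i : nat) : (0 < d)%N ->
  ceil_frac ((k + d)%:Z - i%:Z) d = ceil_frac (k%:Z - i%:Z) d + 1.
Proof.
move=> d_gt0; have := ceil_frac_bounds (k%:Z - i%:Z) d_gt0 => ?.
by apply: ceil_fracP => //; lia.
Qed.

Lemma ceil_frac_le0 (m k : nat) : (k <= m)%N -> ceil_frac (k%:Z - m%:Z) m.+1 = 0.
Proof. by move=> km; apply: ceil_fracP => //; lia. Qed.

(** * Contiguous relations between hypergeometric series *)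

Section Contiguity.

Variable R : comUnitRingType.

Implicit Types (A B : nat -> R) (x : R).

Lemma pochS x n : poch x n.+1 = poch x n * (x + n%:R).
Proof. by rewrite /poch big_ord_recr. Qed.

Lemma pochSl x n : poch x n.+1 = x * poch (x + 1) n.
Proof.
rewrite /poch big_ord_recl /= addr0; congr (_ * _); apply: eq_bigr => i _.
by rewrite -addrA nat1r.
Qed.

Definition poch_prod (r : nat) A (n : nat) : R :=
  \prod_(1 <= i < r.+1) poch (A i) n.

Definition hyper (r s : nat) A B : fps R :=
  pFq [seq A i | i <- iota 1 r] [seq B j | j <- iota 1 s].

Lemma hyperE r s A B n :
  hyper r s A B n = poch_prod r A n / poch_prod s B n / n`!%:R.
Proof. by rewrite /hyper /pFq !big_map /poch_prod /index_iota !subn1. Qed.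

Lemma poch_prod0 r A : poch_prod r A 0 = 1.
Proof. by apply: big1 => i _; rewrite /poch big_ord0. Qed.

Lemma poch_prod_eq r A A' n :
  (forall i, (1 <= i <= r)%N -> A i = A' i) -> poch_prod r A n = poch_prod r A' n.
Proof. by move=> eqA; apply: eq_big_nat => i ir; rewrite eqA. Qed.

Lemma poch_prodSl r A A1 n :
  (forall i, (1 <= i <= r)%N -> A1 i = A i + 1) ->
  poch_prod r A n.+1 = (\prod_(1 <= i < r.+1) A i) * poch_prod r A1 n.
Proof.
move=> A1E; rewrite /poch_prod -big_split /=.
by apply: eq_big_nat => i ir; rewrite pochSl A1E.
Qed.

(** For i <> p one has A_i (A'_i + 1)_n = (A_i)_{n+1}, and the factor of [poch_prod r A1 n] at p is
    (A_p)_n. These make up X; what remains is (A_p)_{n+1} = (A_p + n) (A_p)_n and (A_p - 1)_{n+1} =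
    (A_p - 1) (A_p)_n. *)
Lemma poch_prod_raise r p A A' A1 n : (1 <= p <= r)%N ->
  (forall i, (1 <= i <= r)%N -> A i = A' i + (i == p)%:R) ->
  (forall i, (1 <= i <= r)%N -> A1 i = A' i + 1) ->
  let X := (\prod_(1 <= i < r.+1 | i != p) A i) * poch_prod r A1 n in
  poch_prod r A n.+1 = (A p + n%:R) * X
  /\ poch_prod r A' n.+1 = (A p - 1) * X.
Proof.
move=> pr AE A1E X.
have p_in : p \in index_iota 1 r.+1 by rewrite mem_index_iota ltnS.
have p_uniq := iota_uniq 1 (r.+1 - 1).
have ApE : A p = A' p + 1 by rewrite AE ?eqxx.
have restE : X = poch (A p) n * \prod_(1 <= i < r.+1 | i != p) poch (A i) n.+1.
  rewrite /X /poch_prod (bigD1_seq p) //= mulrCA A1E // -ApE -big_split /=.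
  congr (_ * _); rewrite big_nat_cond [RHS]big_nat_cond.
  apply: eq_bigr => i /andP[ir /negbTE ip].
  by rewrite pochSl A1E // AE // ip addr0.
rewrite restE /poch_prod !(bigD1_seq p p_in p_uniq) /=; split.
  by rewrite pochS [_ * (_ + _)]mulrC mulrA.
rewrite ApE addrK pochSl -!mulrA -ApE; congr (_ * (_ * _)).
rewrite big_nat_cond [RHS]big_nat_cond.
by apply: eq_bigr => i /andP[ir /negbTE ip]; rewrite AE // ip addr0.
Qed.

Lemma poch_unit x n :
  (forall i, x + i%:R \is a GRing.unit) -> poch x n \is a GRing.unit.
Proof. by move=> xU; rewrite unitr_prod. Qed.

Lemma poch_prod_unit r A n :
  (forall j i, (1 <= j <= r)%N -> A j + i%:R \is a GRing.unit) ->
  poch_prod r A n \is a GRing.unit.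
Proof.
move=> AU; rewrite /poch_prod big_nat_cond unitr_prod // => j /andP[jr _].
by apply: poch_unit => i; apply: AU.
Qed.

Section Recurrence.

(** In the application A', B' are the parameters of g_{k-1}, A, B those of g_k, and A1, B1 those of
    g_{k+m}. *)
Variables (r s n : nat) (A A' A1 B B' B1 : nat -> R).
Hypothesis natU : forall i, i.+1%:R \is a @GRing.unit R.
Hypothesis BU : forall j (z : int), (1 <= j <= s)%N ->
  B j + z%:~R \is a GRing.unit.
Hypothesis A1E : forall i, (1 <= i <= r)%N -> A1 i = A' i + 1.
Hypothesis B1E : forall j, (1 <= j <= s)%N -> B1 j = B j + 1.

Let factU i : i`!%:R \is a @GRing.unit R.
Proof.
elim: i => [|i IHi]; first by rewrite unitr1.
by rewrite factS natrM unitrM natU.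
Qed.

Let BnU i : poch_prod s B i \is a GRing.unit.
Proof. by apply: poch_prod_unit => j k js; have := BU k js. Qed.

Let BpU : \prod_(1 <= j < s.+1) B j \is a GRing.unit.
Proof.
rewrite big_nat_cond unitr_prod // => j /andP[js _].
by have := BU 0 js; rewrite addr0.
Qed.

Let B1U : poch_prod s B1 n \is a GRing.unit.
Proof. by have := BnU n.+1; rewrite (poch_prodSl _ B1E) unitrM => /andP[]. Qed.

(** With [factV] and [B'V], this expresses all denominators through (n + 1)! and
    [poch_prod s B n.+1]. *)
Let B1V : (poch_prod s B1 n)^-1
  = (\prod_(1 <= j < s.+1) B j) / poch_prod s B n.+1.
Proof. by rewrite (poch_prodSl _ B1E) invrM // mulrCA divrr // mulr1. Qed.

Let factV : n`!%:R^-1 = n.+1%:R / n.+1`!%:R :> R.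
Proof. by rewrite factS natrM invrM // mulrCA divrr // mulr1. Qed.

Let B'V q : (1 <= q <= s)%N ->
  (forall j, (1 <= j <= s)%N -> B j = B' j + (j == q)%:R) ->
  (poch_prod s B' n.+1)^-1 = (B q + n%:R) / ((B q - 1) * poch_prod s B n.+1).
Proof.
move=> qs BE.
(* Only the ratio of B_q - 1 to B_q + n matters: the shifted family is taken to be B' + 1, and the
   common factor X cancels. *)
have B'1E j : (1 <= j <= s)%N -> B' j + 1 = B' j + 1 by [].
have [] := poch_prod_raise n qs BE B'1E.
move: (_ * poch_prod _ _ _) => X NB NB'.
have BqU : B q - 1 \is a GRing.unit by have := BU (-1) qs.
move: (BnU n.+1); rewrite NB NB' unitrM => /andP[WU XU].
rewrite mulrCA [((B q + n%:R) * _)^-1]invrM ?unitrM ?BqU //.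
by rewrite mulrCA divrr // mulr1.
Qed.

(** Up to a common factor, this is A_p + n = (A_p - 1) + (n + 1). *)
Lemma hyper_raise_upper p : (1 <= p <= r)%N ->
  (forall i, (1 <= i <= r)%N -> A i = A' i + (i == p)%:R) ->
  (forall j, (1 <= j <= s)%N -> B j = B' j) ->
  hyper r s A B n.+1 = hyper r s A' B' n.+1
    + hyper r s A1 B1 n * ((\prod_(1 <= i < r.+1 | i != p) A i)
                           / \prod_(1 <= j < s.+1) B j).
Proof.
move=> pr AE BE; rewrite !hyperE B1V factV -(poch_prod_eq _ BE).
have [-> ->] := poch_prod_raise n pr AE A1E.
(* The inverse of the product E of the B_j becomes a letter [Ei] with E Ei = 1, which leaves
   polynomial identities for [ring]. *)
move: BpU => /divrr; move: (\prod_(1 <= j < _) _)^-1 => Ei.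
move: (\prod_(1 <= j < _) _) => E EV.
rewrite -natr1; set X := \prod_(_ <= _ < _ | _) _.
set C := poch_prod r A1 n; set D := _^-1; set F := _^-1.
transitivity ((A p - 1) * (X * C) * D * F
   + C * D * (n%:R + 1) * F * X * (E * Ei)); last by ring.
by rewrite EV; ring.
Qed.

(** Up to a common factor, this is (A_p + n)(B_q - 1) = (A_p - 1)(B_q + n) + (n + 1)(B_q - A_p). *)
Lemma hyper_raise_both p q : (1 <= p <= r)%N -> (1 <= q <= s)%N ->
  (forall i, (1 <= i <= r)%N -> A i = A' i + (i == p)%:R) ->
  (forall j, (1 <= j <= s)%N -> B j = B' j + (j == q)%:R) ->
  hyper r s A B n.+1 = hyper r s A' B' n.+1
    + hyper r s A1 B1 n *
      (((B q - A p) * \prod_(1 <= i < r.+1 | i != p) A i)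
       / ((B q - 1) * \prod_(1 <= j < s.+1) B j)).
Proof.
move=> pr qs AE BE; rewrite !hyperE B1V factV (B'V qs BE).
have [-> ->] := poch_prod_raise n pr AE A1E.
have BqU : B q - 1 \is a GRing.unit by have := BU (-1) qs.
rewrite [in RHS]invrM // [in ((B q - 1) * _)^-1]invrM //.
move: (divrr BpU); move: (\prod_(1 <= j < _) _)^-1 => Ei.
move: (\prod_(1 <= j < _) _) => E EV.
(* B_q is written as Y + 1, so that the inverse of B_q - 1 is eliminated through Y Yi = 1. *)
move: (divrr BqU); move: (B q - 1)^-1 (esym (subrK 1 (B q))) => Yi.
move: (B q - 1) => Y -> YV.
set X := \prod_(_ <= _ < _ | _) _; set C := poch_prod r A1 n.
set D := _^-1; set F := _^-1; rewrite -natr1.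
transitivity ((A p + n%:R) * (Y * Yi) * (X * C) * D * F); first by rewrite YV; ring.
transitivity ((A p - 1) * (X * C) * ((Y + 1 + n%:R) * (D * Yi)) * F
   + C * D * (n%:R + 1) * F * (Y + 1 - A p) * X * Yi * (E * Ei)); last by ring.
by rewrite EV; ring.
Qed.

(** Up to a common factor, this is B_q - 1 = (B_q + n) - (n + 1), whence the minus sign of the
    coefficient. *)
Lemma hyper_raise_lower q : (1 <= q <= s)%N ->
  (forall i, (1 <= i <= r)%N -> A i = A' i) ->
  (forall j, (1 <= j <= s)%N -> B j = B' j + (j == q)%:R) ->
  hyper r s A B n.+1 = hyper r s A' B' n.+1
    + hyper r s A1 B1 n *
      - ((\prod_(1 <= i < r.+1) A i) / ((B q - 1) * \prod_(1 <= j < s.+1) B j)).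
Proof.
move=> qs AE BE; rewrite !hyperE B1V factV (B'V qs BE).
have A1E' i : (1 <= i <= r)%N -> A1 i = A i + 1 by move=> ir; rewrite A1E // AE.
rewrite -(poch_prod_eq _ AE) (poch_prodSl _ A1E').
have BqU : B q - 1 \is a GRing.unit by have := BU (-1) qs.
rewrite [in RHS]invrM // [in ((B q - 1) * _)^-1]invrM //.
move: (divrr BpU); move: (\prod_(1 <= j < _) B _)^-1 => Ei.
move: (\prod_(1 <= j < _) B _) => E EV.
move: (divrr BqU); move: (B q - 1)^-1 (esym (subrK 1 (B q))) => Yi.
move: (B q - 1) => Y -> YV.
set X := \prod_(_ <= _ < _) _; set C := poch_prod r A1 n.
set D := _^-1; set F := _^-1; rewrite -natr1.
transitivity ((Y * Yi) * (X * C) * D * F); first by rewrite YV; ring.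
transitivity ((X * C) * ((Y + 1 + n%:R) * (D * Yi)) * F
   - C * D * (n%:R + 1) * F * X * Yi * (E * Ei)); last by ring.
by rewrite EV; ring.
Qed.

End Recurrence.

End Contiguity.

(** * From the recurrence to the closed forms *)

(** Both sides are (c + 1) ... (c + n). This turns the contribution of the last upper parameter,
    divided by n!, into the binomial coefficient. *)
Lemma poch_nat_succ (R : pzRingType) (c n : nat) :
  poch (1 + c%:R : R) n = ('C(n + c, n) * n`!)%:R.
Proof.
elim: n => [|n IHn]; first by rewrite /poch big_ord0 bin0.
rewrite /poch big_ord_recr -/(poch _ n) IHn /= nat1r -natrD -natrM.
have := mul_bin_diag (n + c).+1 n; rewrite factS addSn => E.
rewrite mulnA [('C(_, n.+1) * _)%N]mulnC -E /= (addnC c n) mulnAC.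
by rewrite [((n + c).+1 * _)%N]mulnC.
Qed.

Section Shift.

Variable R : comUnitRingType.

(** The common form of all shifted parameters, with K = k + 1 for type k, so that K = 0 gives the
    auxiliary type -1. *)
Definition shift (d : nat) (x : R) (u : nat) (K : int) : R :=
  x + (ceil_frac (K - u%:Z) d)%:~R.

Lemma shift_next d x u (k : nat) : (1 <= u <= d)%N ->
  shift d x u k.+1 = shift d x u k + (u == resid d k)%:R.
Proof. by move=> ud; rewrite /shift ceil_frac_next // intrD addrA; case: eqP. Qed.

Lemma shift_period d x u (k : nat) : (0 < d)%N ->
  shift d x u (k + d)%N = shift d x u k + 1.
Proof. by move=> d0; rewrite /shift ceil_frac_period // intrD addrA. Qed.

(** The part shared by both cases, which then only have to supply the three-term relation. *)
Lemma mSR_hyper (r s m : nat) (u v : nat -> nat) (a b alpha : nat -> R) :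
  (forall i, i.+1%:R \is a @GRing.unit R) ->
  a r.+1 = 1 -> u r.+1 = m.+1 ->
  let A K i := shift m.+1 (a i) (u i) K in
  let B K j := shift m (b j) (v j) K in
  (forall k n : nat,
     hyper r.+1 s (A k.+1) (B k.+1) n.+1
     = hyper r.+1 s (A k) (B k) n.+1
       + hyper r.+1 s (A (k + m).+1) (B (k + m).+1) n * alpha (k + m)%N) ->
  forall k : nat, let K := k%:Z + 1 in
  [/\ (fun n => mSR m k n alpha) =1 hyper r.+1 s (A K) (B K),
      forall n, mSR m k n alpha
        = 'C(n + `|ceil_frac (k%:Z - m%:Z) m.+1|, n)%:R
          * (poch_prod r (A K) n / poch_prod s (B K) n)
    & (k <= m)%N -> forall n, mSR m k n alpha
        = poch_prod r (A K) n / poch_prod s (B K) n].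
Proof.
move=> natU a1 u1 A B HG k K.
have KE : K = k.+1 by rewrite /K; lia.
have Alast (x : int) : A x r.+1 = 1 + (ceil_frac (x - m.+1%:Z) m.+1)%:~R.
  by rewrite /A a1 u1.
have E1 n : mSR m k n alpha = hyper r.+1 s (A K) (B K) n.
  rewrite KE.
  apply: (mSR_unique (G := fun x : nat => hyper r.+1 s (A x) (B x))) => //.
    by move=> x; rewrite hyperE !poch_prod0 divr1 invr1 mulr1.
  move=> {}n; rewrite hyperE {1}/poch_prod big_nat_recr //= Alast.
  (* At K = 0 the last upper parameter is 1 - 1 = 0, and (0)_{n+1} = 0. *)
  rewrite (@ceil_fracP _ (-1)) //; last by lia.
  by rewrite subrr pochSl mul0r mulr0 !mul0r.
have factU i : i`!%:R \is a @GRing.unit R.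
  elim: i => [|i IHi]; first by rewrite unitr1.
  by rewrite factS natrM unitrM natU.
have E2 n : mSR m k n alpha
    = 'C(n + `|ceil_frac (k%:Z - m%:Z) m.+1|, n)%:R
      * (poch_prod r (A K) n / poch_prod s (B K) n).
  rewrite E1 hyperE {1}/poch_prod big_nat_recr //= -/(poch_prod _ _ _) Alast.
  have -> : K - m.+1%:Z = k%:Z - m%:Z by rewrite /K; lia.
  (* The ceiling is nonnegative, so it is a natural number c, and the last upper parameter is 1 +
     c. *)
  have := ceil_frac_ge0 m k; case: (ceil_frac _ _) => // c _.
  rewrite -[(Posz c)%:~R]/(c%:R) poch_nat_succ natrM absz_nat.
  move: (divrr (factU n)); move: (n`!%:R) => F FV.
  rewrite -[RHS]mulr1 -[X in _ = _ * X]FV; ring.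
split=> // km n.
by rewrite E2 ceil_frac_le0 // addn0 binn mul1r.
Qed.

End Shift.

Lemma pos_inP (f : nat -> nat) (n x : nat) :
  if pos_in f n x is Some l then (1 <= l <= n)%N /\ f l = x
  else forall i, (1 <= i <= n)%N -> f i != x.
Proof.
rewrite /pos_in; case: pickP => [l /eqP fl|f_x] /=; first by rewrite ltn_ord.
by case=> // i ir; have := f_x (Ordinal ir) => /= ->.
Qed.

(** Ensures that at most one of the parameters placed by f is raised from one type to the next. *)
Lemma increasing_within_inj (f : nat -> nat) (n N i j : nat) :
  increasing_within f n N -> (1 <= i <= n)%N -> (1 <= j <= n)%N ->
  (f i == f j) = (i == j).
Proof.
move=> [_ f_incr] ir jr.
by case: (ltngtP i j) => [ij|ji|->]; rewrite ?eqxx //;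
  [have := f_incr i j | have := f_incr j i]; lia.
Qed.

(** * The three-term relation for r >= s and for r <= s *)

Section Cases.

Variables (R : comUnitRingType) (r s : nat) (a b : nat -> R).
Hypothesis natU : forall i, i.+1%:R \is a @GRing.unit R.
Hypothesis bU : forall j (z : int), (1 <= j <= s)%N ->
  b j + z%:~R \is a GRing.unit.

Let shiftU d v K j (z : int) : (1 <= j <= s)%N ->
  shift d (b j) v K + z%:~R \is a GRing.unit.
Proof. by move=> js; rewrite /shift -addrA -intrD bU. Qed.

(** From type k - 1 to type k the upper parameter of index [k]_{r+1} always goes up by 1; a lower
    one does so exactly when [k]_r is some lambda_l. *)
Lemma hyper_rec_ge (lambda : nat -> nat) (k n : nat) :
  (0 < r)%N -> increasing_within lambda s r ->
  let A K i := shift r.+1 (a i) i K in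
  let B K j := shift r (b j) (lambda j) K in
  hyper r.+1 s (A k.+1) (B k.+1) n.+1
  = hyper r.+1 s (A k) (B k) n.+1
    + hyper r.+1 s (A (k + r).+1) (B (k + r).+1) n
      * alpha_ge r s a b lambda (k + r).
Proof.
move=> r0 lam A B.
have pr := resid_range k (ltn0Sn r).
(* The shift k + r + 1 is read as k + (r + 1) for the upper parameters, of period r + 1, and as (k +
   1) + r for the lower ones, of period r. *)
have A1E i : (1 <= i <= r.+1)%N -> A (k + r).+1 i = A k i + 1.
  by move=> _; rewrite /A -addnS shift_period.
have B1E j : (1 <= j <= s)%N -> B (k + r).+1 j = B k.+1 j + 1.
  by move=> _; rewrite /B -addSn shift_period.
have AE i : (1 <= i <= r.+1)%N -> A k.+1 i = A k i + (i == resid r.+1 k)%:R.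
  by move=> ir; rewrite /A shift_next.
have BE j : (1 <= j <= s)%N ->
    B k.+1 j = B k j + (lambda j == resid r k)%:R.
  by move=> js; rewrite /B shift_next // (proj1 lam).
have BU j (z : int) : (1 <= j <= s)%N -> B k.+1 j + z%:~R \is a GRing.unit.
  exact: shiftU.
have KE : k.+1%:Z = k%:Z + 1 by lia.
rewrite /alpha_ge addnK /coef_ge.
have := pos_inP lambda s (resid r k); case: pos_in => [l [lr le]|lne].
  have BEl j : (1 <= j <= s)%N -> B k.+1 j = B k j + (j == l)%:R.
    by move=> js; rewrite BE // -le (increasing_within_inj lam).
  by rewrite (hyper_raise_both n natU BU A1E B1E pr lr AE BEl) KE.
have BEl j : (1 <= j <= s)%N -> B k.+1 j = B k j.
  by move=> js; rewrite BE // (negbTE (lne j js)) addr0.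
by rewrite (hyper_raise_upper n natU BU A1E B1E pr AE BEl) KE.
Qed.

(** The roles are exchanged: the lower parameter of index [k]_s always goes up, an upper one only
    when [k]_{s+1} is some sigma_l. *)
Lemma hyper_rec_le (sigma : nat -> nat) (k n : nat) :
  (0 < s)%N -> increasing_within sigma r.+1 s.+1 ->
  let A K i := shift s.+1 (a i) (sigma i) K in
  let B K j := shift s (b j) j K in
  hyper r.+1 s (A k.+1) (B k.+1) n.+1
  = hyper r.+1 s (A k) (B k) n.+1
    + hyper r.+1 s (A (k + s).+1) (B (k + s).+1) n
      * alpha_le r s a b sigma (k + s).
Proof.
move=> s0 sig A B.
have qs := resid_range k s0.
have A1E i : (1 <= i <= r.+1)%N -> A (k + s).+1 i = A k i + 1.
  by move=> _; rewrite /A -addnS shift_period.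
have B1E j : (1 <= j <= s)%N -> B (k + s).+1 j = B k.+1 j + 1.
  by move=> _; rewrite /B -addSn shift_period.
have AE i : (1 <= i <= r.+1)%N ->
    A k.+1 i = A k i + (sigma i == resid s.+1 k)%:R.
  by move=> ir; rewrite /A shift_next // (proj1 sig).
have BE j : (1 <= j <= s)%N -> B k.+1 j = B k j + (j == resid s k)%:R.
  by move=> js; rewrite /B shift_next.
have BU j (z : int) : (1 <= j <= s)%N -> B k.+1 j + z%:~R \is a GRing.unit.
  exact: shiftU.
have KE : k.+1%:Z = k%:Z + 1 by lia.
rewrite /alpha_le addnK /coef_le.
have := pos_inP sigma r.+1 (resid s.+1 k); case: pos_in => [l [lr le]|lne].
  have AEl i : (1 <= i <= r.+1)%N -> A k.+1 i = A k i + (i == l)%:R.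
    by move=> ir; rewrite AE // -le (increasing_within_inj sig).
  by rewrite (hyper_raise_both n natU BU A1E B1E lr qs AEl BE) KE.
have AEl i : (1 <= i <= r.+1)%N -> A k.+1 i = A k i.
  by move=> ir; rewrite AE // (negbTE (lne i ir)) addr0.
by rewrite (hyper_raise_lower n natU BU A1E B1E qs AEl BE) KE.
Qed.

End Cases.

(** * Units of the coefficient ring and conclusion *)

(** A positive integer is a constant from the field Q(b_1, ..., b_s), nonzero because the
    characteristic is 0. *)
Lemma coefring_nat_unit (r s n : nat) :
  n.+1%:R \is a @GRing.unit (coefring r s).
Proof.
have -> : n.+1%:R = (n.+1%:R : ratfrac s)%:MP_[r] by rewrite rmorph_nat.
rewrite unfold_in /= /mpoly_unit mcoeffC eqxx mulr1 unitfE eqxx /=.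
rewrite -(rmorph_nat (@tofrac _)) tofrac_eq0 -(rmorph_nat (@mpolyC s _)).
by rewrite mpolyC_eq0 pnatr_eq0.
Qed.

Theorem corollary5p7 (r s : nat) (a b : nat -> coefring r s)
  (hm : (1 <= maxn r s)%N)
  (ha : forall i : 'I_r, a i.+1 = var_a s i)
  (ha1 : a r.+1 = 1)
  (hb : forall j : 'I_s, b j.+1 = var_b r j) :
  let m := maxn r s in
  ((s <= r)%N ->
   forall lambda : nat -> nat,
   increasing_within lambda s r ->
   let A := a_ge r a in
   let B := b_ge r b lambda in
   let alpha := alpha_ge r s a b lambda in
   forall k : nat,
     [/\ (fun n => mSR m k n alpha)
           =1 pFq [seq A k i | i <- iota 1 r.+1] [seq B k j | j <- iota 1 s],
         forall n : nat,
           mSR m k n alpha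
           = 'C(n + `|ceil_frac (k%:Z - m%:Z) m.+1|, n)%:R
             * ((\prod_(1 <= i < r.+1) poch (A k i) n)
                / \prod_(1 <= j < s.+1) poch (B k j) n)
       & (k <= m)%N -> forall n : nat,
           mSR m k n alpha
           = (\prod_(1 <= i < r.+1) poch (A k i) n)
             / \prod_(1 <= j < s.+1) poch (B k j) n])
  /\
  ((r <= s)%N ->
   forall sigma : nat -> nat,
   increasing_within sigma r s ->
   sigma r.+1 = s.+1 ->
   let A := a_le s a sigma in
   let B := b_le s b in
   let alpha := alpha_le r s a b sigma in
   forall k : nat,
     [/\ (fun n => mSR m k n alpha)
           =1 pFq [seq A k i | i <- iota 1 r.+1] [seq B k j | j <- iota 1 s],
         forall n : nat,
           mSR m k n alpha
           = 'C(n + `|ceil_frac (k%:Z - m%:Z) m.+1|, n)%:R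
             * ((\prod_(1 <= i < r.+1) poch (A k i) n)
                / \prod_(1 <= j < s.+1) poch (B k j) n)
       & (k <= m)%N -> forall n : nat,
           mSR m k n alpha
           = (\prod_(1 <= i < r.+1) poch (A k i) n)
             / \prod_(1 <= j < s.+1) poch (B k j) n]).
Proof.
have natU := coefring_nat_unit r s.
have bU j (z : int) : (1 <= j <= s)%N -> b j + z%:~R \is a GRing.unit.
  by case: j => // j js; rewrite (hb (Ordinal js)) var_b_unit.
move=> m; split=> [sr lambda lam|rs sigma sig sig1].
  have -> : m = r by apply/maxn_idPl.
  have r0 : (0 < r)%N by rewrite /m (maxn_idPl sr) in hm.
  (* With u the identity, the condition on u at r + 1 holds by computation. *)
  apply: (mSR_hyper (u := id) (v := lambda) natU ha1) => // k n.
  exact: hyper_rec_ge.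
have -> : m = s by apply/maxn_idPr.
have s0 : (0 < s)%N by rewrite /m (maxn_idPr rs) in hm.
apply: (mSR_hyper (v := id) natU ha1 sig1) => k n.
(* Adjoining sigma_{r+1} = s + 1 keeps sigma increasing, now with r + 1 values in 1, ..., s + 1. *)
apply: hyper_rec_le => //; case: sig => sig_range sig_incr.
have sigS i : (1 <= i <= r)%N -> (1 <= sigma i <= s)%N by exact: sig_range.
split=> [i ir|i j i1 ij jr].
  have [->|ir'] := eqVneq i r.+1; first by rewrite sig1; lia.
  by have := sigS i; lia.
have [jE|jr'] := eqVneq j r.+1; last by apply: sig_incr; lia.
by rewrite jE sig1; have := sigS i; lia.
Qed.
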